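(* Let $R$ be a commutative ring with non-zero identity, $M$ a non-zero unital $R$-module, and $K\subset N$ submodules of $M$. If $N$ is a 1-absorbing prime submodule of $M$, then $N/K$ is a 1-absorbing prime submodule of $M/K$.
   Context: For a submodule $N$ of an $R$-module $M$, $(N:M)=\{r\in R: rM\subseteq N\}$. A proper submodule $N$ of an $R$-module $M$ is 1-absorbing prime if for all non-unit elements $a,b\in R$ and all $m\in M$, $abm\in N$ implies $ab\in(N:M)$ or $m\in N$. *)

(* Defs.v *)
From HB Require Import structures.
From mathcomp Require Import all_boot all_algebra.
From mathcomp Require Import boolp classical_sets.

Set Implicit Arguments.
Unset Strict Implicit.
Unset Printing Implicit Defensive.

Import GRing.Theory.
Import Quotient.Exports.
Local Open Scope ring_scope.
Local Open Scope quotient_scope.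

Section ModuleQuotient.

Variables (R : nzRingType) (M : lmodType R) (K : submodClosed M).

(* [Quotient.quot] requires a predicate that is explicitly closed under
   opposite, whereas [submodClosed] is stated over semirings and only provides
   closure under 0, addition and scaling. *)
Definition submod_zmod : {pred M} := fun x => x \in K.

Fact submod_zmod_closed : zmod_closed submod_zmod.
Proof. exact: GRing.submod_closedB (submodClosedP K). Qed.

HB.instance Definition _ :=
  GRing.isZmodClosed.Build M submod_zmod submod_zmod_closed.

Definition quot_mod : Type := Quotient.quot submod_zmod.

HB.instance Definition _ := GRing.Zmodule.on quot_mod.
HB.instance Definition _ := EqQuotient.on quot_mod.

Definition quot_mod_scale (a : R) (x : quot_mod) : quot_mod :=
  \pi_quot_mod (a *: repr x).

Lemma eq_pi_quot_mod (x y : M) :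
  (\pi_quot_mod x == \pi_quot_mod y) = (x - y \in K).
Proof. by rewrite -[RHS]/(x - y \in submod_zmod) Quotient.idealrBE. Qed.

Lemma pi_quot_modD (x y : M) :
  \pi_quot_mod (x + y) = \pi_quot_mod x + \pi_quot_mod y.
Proof. exact: Quotient.pi_add. Qed.

Lemma pi_quot_modZ (a : R) (x : M) :
  \pi_quot_mod (a *: x) = quot_mod_scale a (\pi_quot_mod x).
Proof.
apply/eqP; rewrite eq_pi_quot_mod -scalerBr rpredZ //.
by rewrite -eq_pi_quot_mod reprK.
Qed.

Fact quot_mod_scaleA a b x :
  quot_mod_scale a (quot_mod_scale b x) = quot_mod_scale (a * b) x.
Proof.
elim/quotW: x => x.
by rewrite -(pi_quot_modZ b x) -(pi_quot_modZ a (b *: x)) scalerA pi_quot_modZ.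
Qed.

Fact quot_mod_scale1 : left_id 1 quot_mod_scale.
Proof. by elim/quotW => x; rewrite -pi_quot_modZ scale1r. Qed.

Fact quot_mod_scaleDr : right_distributive quot_mod_scale +%R.
Proof.
move=> a; elim/quotW=> x; elim/quotW=> y.
by rewrite -pi_quot_modD -!pi_quot_modZ scalerDr pi_quot_modD.
Qed.

Fact quot_mod_scaleDl x :
  {morph quot_mod_scale^~ x : a b / a + b}.
Proof.
by elim/quotW: x => x a b; rewrite -!pi_quot_modZ scalerDl pi_quot_modD.
Qed.

HB.instance Definition _ := GRing.Zmodule_isLmodule.Build R quot_mod
  quot_mod_scaleA quot_mod_scale1 quot_mod_scaleDr quot_mod_scaleDl.

(* The image of N in M / K, which is N / K when K is contained in N. *)
Definition quot_submod (N : submodClosed M) : {pred quot_mod} :=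
  fun x => `[< exists2 n, n \in N & x = \pi_quot_mod n >].

Fact quot_submod_closed (N : submodClosed M) : submod_closed (quot_submod N).
Proof.
split=> [|a x y /asboolP[m Nm ->] /asboolP[n Nn ->]]; apply/asboolP.
  exists 0; first exact: rpred0.
  by apply: (addrI (\pi_quot_mod 0)); rewrite -pi_quot_modD !addr0.
exists (a *: m + n); first by rewrite rpredD ?rpredZ.
by rewrite pi_quot_modD pi_quot_modZ.
Qed.

HB.instance Definition _ (N : submodClosed M) :=
  GRing.isSubmodClosed.Build R quot_mod (quot_submod N)
    (GRing.submod_closed_semi (quot_submod_closed N)).

End ModuleQuotient.

Arguments quot_mod {R M} K.
Arguments quot_submod {R M} K N.

(* Stated for a bare [comNzRingType], so that no decision procedure for
   invertibility is assumed; it agrees with [GRing.unit] by [unitrP]. *)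
Definition invertible (R : comNzRingType) (a : R) : Prop :=
  exists b : R, a * b = 1.

Definition colon (R : comNzRingType) (M : lmodType R) (N : submodClosed M) :
    set R :=
  [set r | forall m : M, r *: m \in N]%classic.

Definition one_absorbing_prime (R : comNzRingType) (M : lmodType R)
    (N : submodClosed M) : Prop :=
  (exists m : M, m \notin N) /\
  (forall (a b : R) (m : M), ~ invertible a -> ~ invertible b ->
     (a * b) *: m \in N -> colon N (a * b) \/ m \in N).

(* Main.v *)
Require Import Defs.
From mathcomp Require Import all_boot all_algebra.
From mathcomp Require Import boolp.
Import GRing.Theory.
Local Open Scope ring_scope.
Local Open Scope quotient_scope.

(** Because [K] lies inside [N], the preimage of [N/K] under the projection from [M] to [M/K] is
    exactly [N] ([mem_quot_submod_pi]). The projection is linear and surjective, so properness, the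
    absorbing hypothesis and the colon condition all pull back to [N], with the scalars [a] and [b]
    unchanged. *)

Lemma mem_quot_submod_pi (R : nzRingType) (M : lmodType R)
    (K N : submodClosed M) (x : M) :
  {subset K <= N} -> (\pi_(quot_mod K) x \in quot_submod K N) = (x \in N).
Proof.
move=> sKN; apply/asboolP/idP => [[n Nn /eqP]|Nx]; last by exists x.
(* Equal classes give [x - n] in [K], hence in [N], and [x = (x - n) + n]. *)
by rewrite eq_pi_quot_mod => /sKN Nxn; rewrite -(subrK n x) rpredD.
Qed.

Theorem corollary2 (R : comNzRingType) (M : lmodType R) (K N : submodClosed M)
    (M_neq0 : exists m : M, m != 0)
    (K_sub_N : {subset K <= N})
    (N_prime : one_absorbing_prime N) :
  one_absorbing_prime (quot_submod K N).
Proof.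
have memN x := @mem_quot_submod_pi R M K N x K_sub_N.
have piZ (a : R) (x : M) :
    a *: \pi_(quot_mod K) x = \pi_(quot_mod K) (a *: x).
  by rewrite pi_quot_modZ.
case: N_prime => [[m Nm] absN]; split; first by exists (\pi m); rewrite memN.
move=> a b; elim/quotW=> x a_nunit b_nunit.
rewrite piZ !memN => /(absN _ _ _ a_nunit b_nunit)[abM | Nx]; last by right.
(* Every class has a representative [y] in [M], so [(N:M)] is contained in [(N/K : M/K)]. *)
by left; elim/quotW=> y; rewrite piZ memN; apply: abM.
Qed.
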